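(* Let $l$ be a positive integer and let $P$ be an $l$-reflexive loop in $N=\mathbb{Z}^2$. Let $\Lambda_P$ be the lattice generated by the boundary lattice points of $P$. Then $P$ is a $1$-reflexive loop with respect to the lattice $\Lambda_P$ (called the $1$-reflexive loop associated to $P$). Moreover, its dual $1$-reflexive loop is isomorphic to the $1$-reflexive loop associated to the dual $l$-reflexive loop $lP^*$, i.e. to $lP^*$ regarded as a $1$-reflexive loop with respect to the lattice $\Lambda_{lP^*}$ generated by its boundary lattice points.
   Context: Let $M=\mathrm{Hom}(N,\mathbb{Z})\cong\mathbb{Z}^2$. A nonzero lattice point $x$ is primitive if the segment from $\mathbf{0}$ to $x$ contains no lattice points other than its endpoints. $l$-reflexive loop: let $x_1,\dots,x_t$ be nonzero points of a rank-two lattice and put $x_0:=x_t$, $x_{t+1}:=x_1$. They are the boundary lattice points of an $l$-reflexive loop $P$ (with respect to that lattice) if for each $i=1,\dots,t$: (1) $x_{i+1}-x_i$ is primitive; (2) the determinant (with respect to a lattice basis) of the $2\times2$ matrix formed by $x_i,x_{i+1}$ equals $\pm l$; (3) if $x_i$ is a vertex (i.e. $x_i\notin\mathrm{conv}\{x_{i-1},x_{i+1}\}$) then $x_i$ is primitive. The loop may be a non-convex or self-intersecting polygonal loop. Dual loop: for each $i$ let $u_i$ be the primitive outer normal to the segment $\mathrm{conv}\{x_i,x_{i+1}\}$, i.e. the unique primitive point of the dual lattice with $\langle u_i,x_i\rangle=\langle u_i,x_{i+1}\rangle=l$. The dual $l$-reflexive loop $lP^*$ is the loop in the dual lattice whose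 boundary lattice points are the dual-lattice points of $\bigcup_{i=1}^t\mathrm{conv}\{u_i,u_{i+1}\}$ (indices cyclic), traversed successively from $u_i$ to $u_{i+1}$, immediate repetitions omitted. Two loops in lattices $L,L'$ are isomorphic if there is a lattice isomorphism $L\cong L'$ mapping the cyclic sequence of boundary lattice points of one onto that of the other.
   Formalization: The claim about the dual loops is stated for loops P not contained in a line; for P on one line (e.g. l = 1 with boundary points (1,0),(0,1)) all outer normals coincide, lP* is a single point and its lattice has rank one, so the claim fails. *)

(* Defs.v *)
From mathcomp Require Import all_boot all_order all_algebra.

Set Implicit Arguments.
Unset Strict Implicit.
Unset Printing Implicit Defensive.

Import Order.TTheory GRing.Theory Num.Theory.
Local Open Scope ring_scope.

(* All lattices live in the rational plane: N is the set of integral points, *)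
(* and Hom(L, Z) is identified with the set of u whose pairing with every    *)
(* point of L is an integer.                                                 *)
Definition point := 'rV[rat]_2.
Definition lattice := point -> Prop.

Definition pairing (u v : point) : rat := (u *m v^T) 0 0.

(* The rows of B form a Z-basis of L, and L has rank two. *)
Definition lattice_basis (L : lattice) (B : 'M[rat]_2) : Prop :=
  B \in unitmx /\
  forall v : point, L v <-> exists c : 'rV[int]_2, v = map_mx intr c *m B.

Definition std_lattice : lattice := fun v => forall j, v 0 j \is a Num.int.

Definition generated_lattice (s : seq point) : lattice :=
  fun v => inIntSpan (in_tuple s) v.

Definition dual_lattice (L : lattice) : lattice :=
  fun u => forall v, L v -> pairing u v \is a Num.int.

Definition in_segment (x y z : point) : Prop :=
  exists2 a : rat, 0 <= a <= 1 & z = (1 - a) *: x + a *: y.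

Definition primitive (L : lattice) (x : point) : Prop :=
  [/\ L x, x != 0 &
      forall z, L z -> in_segment 0 x z -> z = 0 \/ z = x].

(* Determinant of the matrix with rows x, y in the coordinates of basis B. *)
Definition det_wrt (B : 'M[rat]_2) (x y : point) : rat :=
  \det ((col_mx x y : 'M[rat]_2) *m invmx B).

(* A loop is the list of its boundary lattice points; indices are cyclic and *)
(* start at 0.  The predecessor of i is written i + (size s).-1, so as to    *)
(* avoid truncated subtraction.                                              *)
Definition cyc (s : seq point) (i : nat) : point := s`_(i %% size s).
Definition cyc_next (s : seq point) (i : nat) : point := cyc s i.+1.
Definition cyc_prev (s : seq point) (i : nat) : point :=
  cyc s (i + (size s).-1).

Definition is_vertex (s : seq point) (i : nat) : Prop :=
  ~ in_segment (cyc_prev s i) (cyc_next s i) (cyc s i).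

Definition reflexive_loop (L : lattice) (l : nat) (s : seq point) : Prop :=
  [/\ s != [::],
      forall x, x \in s -> L x /\ x != 0
    & exists2 B : 'M[rat]_2, lattice_basis L B &
      forall i, (i < size s)%N ->
        [/\ primitive L (cyc_next s i - cyc s i),
            `|det_wrt B (cyc s i) (cyc_next s i)| = l%:R
          & is_vertex s i -> primitive L (cyc s i)]].

Definition outer_normal (L : lattice) (l : nat) (x y u : point) : Prop :=
  [/\ primitive (dual_lattice L) u, pairing u x = l%:R & pairing u y = l%:R].

(* p lists the points of L on conv{u, v}, each once, from u to v. *)
Definition traverses (L : lattice) (u v : point) (p : seq point) : Prop :=
  [/\ uniq p,
      forall z, z \in p <-> L z /\ in_segment u v z
    & exists2 a : seq rat, sorted <=%O a & p = [seq u + r *: (v - u) | r <- a]].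

(* Immediate repetitions are omitted cyclically: the last point counts as    *)
(* preceding the first.  A constant list becomes a single point.             *)
Definition omit_repeats (s : seq point) : seq point :=
  if constant s then take 1 s
  else [seq cyc s i | i <- iota 0 (size s) & cyc s i != cyc_prev s i].

(* d is the dual of the l-reflexive loop s with respect to L: u lists the    *)
(* outer normals, and ps the lists of lattice points of the segments         *)
(* conv{u_i, u_(i+1)}.                                                       *)
Definition dual_loop (L : lattice) (l : nat) (s d : seq point) : Prop :=
  exists (u : seq point) (ps : seq (seq point)),
    [/\ size u = size s /\ size ps = size s,
        forall i, (i < size s)%N ->
          outer_normal L l (cyc s i) (cyc_next s i) (cyc u i),
        forall i, (i < size s)%N ->
          traverses (dual_lattice L) (cyc u i) (cyc_next u i) (nth [::] ps i)
      & d = omit_repeats (flatten ps)].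

(* f is only meaningful on L.  The equality up to rotation expresses that    *)
(* the cyclic sequences correspond, with the direction of travel preserved.  *)
Definition loop_isomorphic
    (L : lattice) (s : seq point) (L' : lattice) (s' : seq point) : Prop :=
  exists f : point -> point,
    [/\ forall v, L v -> L' (f v),
        forall v w, L v -> L w -> f (v + w) = f v + f w,
        forall v w, L v -> L w -> f v = f w -> v = w,
        forall w, L' w -> exists2 v, L v & f v = w
      & exists k, map f s = rot k s'].

(* A loop running back and forth on one line has a single outer normal, so   *)
(* its dual is one point, which generates no rank-two lattice.               *)
Definition contained_in_line (s : seq point) : Prop :=
  exists p q : point, forall x, x \in s -> exists a : rat, x = p + a *: q.

(* Main.v *)
Require Import Defs.
From mathcomp Require Import all_boot all_order all_algebra.
From mathcomp Require Import zify ring lra.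
From Stdlib Require Import Classical.

Set Implicit Arguments.
Unset Strict Implicit.
Unset Printing Implicit Defensive.

Import Order.TTheory GRing.Theory Num.Theory.
Local Open Scope ring_scope.

(* The key point is that consecutive boundary points x_i, x_(i+1) all generate *)
(* one and the same lattice: since det(x_i, x_(i+1)) and det(x_(i+1), x_(i+2)) *)
(* agree up to sign, x_(i+2) is an integral combination of x_i and x_(i+1).    *)
(* Hence consecutive points have determinant 1 or -1 in that lattice.  The     *)
(* outer normals of P for the two lattices differ by the factor l; where two   *)
(* successive normals differ, x_(i+1) is primitive and the edge of the dual    *)
(* loop runs along its quarter turn, so all lattice points of the two dual     *)
(* loops also differ by the factor l, and this homothety is the isomorphism.   *)

(** * Determinants, lattice bases and primitive points *)

(** [loop_recurrence] writes each point as an integral combination of its two predecessors, so the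
    independent points x_0 and x_1 form a basis of the generated lattice ([generated_basis]). In
    that basis a determinant of neighbours is a quotient of two determinants of absolute value l,
    and primitivity passes to sublattices; this is [generated_reflexive].

    For the dual loop, a segment conv{u_i, u_(i+1)} of positive length forces x_(i+1) to be
    primitive ([distinct_normals_primitive]). All points of the segment pair to l with x_(i+1), so a
    step between neighbouring lattice points is plus or minus the quarter turn of x_(i+1), and its
    determinant is plus or minus l ([dual_step]). Hence the dual loop is l-reflexive as soon as it
    is not a single point ([dual_reflexive]).

    Multiplication by l carries the dual for the generated lattice, point by point, onto the dual
    for the original lattice ([segment_scale], [dual_loop_scale]). It is a lattice isomorphism onto
    the lattice generated by the image, because a 1-reflexive loop generates its whole lattice
    ([reflexive1_generated]). *)

Definition det2 (x y : point) : rat := x 0 0 * y 0 1 - x 0 1 * y 0 0.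

Lemma point_eqP (x y : point) : x = y <-> x 0 0 = y 0 0 /\ x 0 1 = y 0 1.
Proof.
split=> [-> //|[e0 e1]]; apply/rowP => j.
case: (unliftP 0 j) => [i ->|-> //]; rewrite (ord1 i).
by have -> : lift 0 0 = 1 :> 'I_2 by exact: val_inj.
Qed.

Lemma pairingE (u v : point) : pairing u v = u 0 0 * v 0 0 + u 0 1 * v 0 1.
Proof.
rewrite /pairing !mxE big_ord_recl big_ord1 !mxE.
by have -> : lift 0 0 = 1 :> 'I_2 by exact: val_inj.
Qed.

Lemma pairingDl u v x : pairing (u + v) x = pairing u x + pairing v x.
Proof. by rewrite !pairingE !mxE; ring. Qed.

Lemma pairingZl a u x : pairing (a *: u) x = a * pairing u x.
Proof. by rewrite !pairingE !mxE; ring. Qed.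

Lemma pairingDr u x y : pairing u (x + y) = pairing u x + pairing u y.
Proof. by rewrite !pairingE !mxE; ring. Qed.

Lemma pairingZr a u x : pairing u (a *: x) = a * pairing u x.
Proof. by rewrite !pairingE !mxE; ring. Qed.

Lemma col_mx2E (x y : point) (i j : 'I_2) :
  (col_mx x y : 'M[rat]_2) i j = if i == 0 then x 0 j else y 0 j.
Proof.
rewrite mxE; case: splitP => k /=; rewrite (ord1 k) => ik.
  by have -> : i = 0 by exact: val_inj.
by have -> : i = 1 by exact: val_inj.
Qed.

Lemma det_mx2 (M : 'M[rat]_2) : \det M = M 0 0 * M 1 1 - M 0 1 * M 1 0.
Proof.
rewrite (expand_det_row _ 0) big_ord_recl big_ord1 /cofactor !det_mx11 !mxE /=.
have -> : lift 0 0 = 1 :> 'I_2 by exact: val_inj.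
have -> : lift 1 0 = 0 :> 'I_2 by exact: val_inj.
by rewrite expr0 expr1 mul1r mulN1r mulrN.
Qed.

Lemma det_col_mx2 (x y : point) : \det (col_mx x y : 'M[rat]_2) = det2 x y.
Proof. by rewrite det_mx2 !col_mx2E. Qed.

Lemma det_wrtE (B : 'M[rat]_2) x y : det_wrt B x y = det2 x y / \det B.
Proof. by rewrite /det_wrt det_mulmx det_inv det_col_mx2. Qed.

Lemma det2C x y : det2 x y = - det2 y x. Proof. by rewrite /det2; ring. Qed.

Lemma det2_cramer x y z : det2 x y != 0 ->
  z = (det2 z y / det2 x y) *: x + (det2 x z / det2 x y) *: y.
Proof. by rewrite /det2 => h; apply/point_eqP; rewrite !mxE; split; field. Qed.

Lemma mul_row2 (c : 'rV[rat]_2) (x y : point) :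
  c *m (col_mx x y : 'M[rat]_2) = c 0 0 *: x + c 0 1 *: y.
Proof.
apply/rowP => j; rewrite 3!mxE big_ord_recl big_ord1 !col_mx2E !mxE.
by have -> : lift 0 0 = 1 :> 'I_2 by exact: val_inj.
Qed.

Lemma lattice_basisP L B : lattice_basis L B -> forall v, L v <->
  forall j, (v *m invmx B) 0 j \is a Num.int.
Proof.
move=> [uB LB] v; rewrite LB; split=> [[c ->] j|h].
  by rewrite mulmxK // mxE intr_int.
move: h; rewrite -{2}(mulmxKV uB v); move: (v *m _) => w h.
exists (\row_j Num.floor (w 0 j)); congr (_ *m _).
by apply/rowP => j; apply/esym/eqP; rewrite !mxE -intrEfloor.
Qed.

Lemma lattice_comb L B x y a b : lattice_basis L B -> L x -> L y ->
  a \is a Num.int -> b \is a Num.int -> L (a *: x + b *: y).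
Proof.
move=> bL /(lattice_basisP bL) Lx /(lattice_basisP bL) Ly ia ib.
apply/(lattice_basisP bL) => j.
by rewrite mulmxDl -!scalemxAl !mxE rpredD // rpredM //;
  [have := Lx j | have := Ly j]; rewrite mxE.
Qed.

Lemma latticeZ L B x a : lattice_basis L B -> L x ->
  a \is a Num.int -> L (a *: x).
Proof.
move=> bL Lx ia; rewrite -[_ *: _]addr0 -(scale0r x).
by apply: (lattice_comb bL).
Qed.

Lemma latticeD L B x y : lattice_basis L B -> L x -> L y -> L (x + y).
Proof.
by move=> bL Lx Ly; rewrite -[x]scale1r -[y]scale1r; apply: (lattice_comb bL).
Qed.

Lemma latticeB L B x y : lattice_basis L B -> L x -> L y -> L (x - y).
Proof.
move=> bL Lx Ly; rewrite -[x]scale1r -scaleN1r.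
by apply: (lattice_comb bL); rewrite ?rpredN.
Qed.

Lemma lattice0 L B : lattice_basis L B -> L 0.
Proof. by move=> bL; apply/(lattice_basisP bL) => j; rewrite mul0mx mxE. Qed.

Lemma lattice_basis_neq0 L B : lattice_basis L B -> \det B != 0.
Proof. by case; rewrite unitmxE unitfE. Qed.

Lemma lattice_basis_row L B i : lattice_basis L B -> L (row i B).
Proof.
move=> bL; case: (bL) => uB _; apply/(lattice_basisP bL) => j.
by rewrite -row_mul mulmxV // !mxE; case: eqP; rewrite ?mulr1n ?mulr0n.
Qed.

Lemma det_wrt_int L B x y : lattice_basis L B -> L x -> L y ->
  det_wrt B x y \is a Num.int.
Proof.
move=> [uB LB] /LB[c ->] /LB[d ->]; rewrite /det_wrt -mul_col_mx mulmxK //.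
rewrite det_mx2 !col_mx2E /= !mxE.
by rewrite rpredB // rpredM // intr_int.
Qed.

(** The determinant form is unimodular on a rank-two lattice: the coordinates of [w] in the basis
    [B] are, up to sign, its determinants with the two rows of [B]. *)
Lemma lattice_det_int L B w : lattice_basis L B ->
  (forall v, L v -> det_wrt B w v \is a Num.int) -> L w.
Proof.
move=> bL h; set b0 := row 0 B; set b1 := row 1 B.
have dB : det2 b0 b1 = \det B by rewrite /det2 det_mx2 !mxE.
have dB0 := lattice_basis_neq0 bL.
rewrite (det2_cramer (x := b0) (y := b1) w) ?dB //.
apply: (lattice_comb bL); rewrite ?dB -?det_wrtE; try exact: lattice_basis_row.
  by apply: h; apply: lattice_basis_row.
rewrite det_wrtE det2C mulNr rpredN -det_wrtE; apply: h.
exact: lattice_basis_row bL.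
Qed.

(** By Cramer's rule the coefficients are integral determinants divided by 1 or -1. *)
Lemma unimodular_span L B x y v : lattice_basis L B -> L x -> L y ->
  `|det_wrt B x y| = 1 -> L v ->
  exists a b, [/\ a \is a Num.int, b \is a Num.int & v = a *: x + b *: y].
Proof.
move=> bL Lx Ly d1 Lv.
have i1 : (det_wrt B x y)^-1 \is a Num.int.
  have /eqP : `|det_wrt B x y| = 1 by [].
  by rewrite eqr_norml => /andP[/orP[]/eqP -> _]; rewrite ?invrN invr1 ?rpredN.
have nz : det_wrt B x y != 0 by rewrite -normr_eq0 d1.
have dB0 := lattice_basis_neq0 bL.
have nz2 : det2 x y != 0.
  by apply: contraNneq nz; rewrite det_wrtE => ->; rewrite mul0r.
have E p q : det2 p q / det2 x y = det_wrt B p q * (det_wrt B x y)^-1.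
  by rewrite !det_wrtE; field; rewrite dB0.
exists (det2 v y / det2 x y), (det2 x v / det2 x y).
by split; [| |exact: det2_cramer]; rewrite E rpredM // (det_wrt_int bL).
Qed.

Lemma primitive_scale01 L x z a : primitive L x -> L z -> z = a *: x ->
  0 <= a <= 1 -> a = 0 \/ a = 1.
Proof.
move=> [Lx x0 Px] Lz zE a01; case: (Px z Lz).
- by exists a; rewrite // scaler0 add0r.
- by rewrite zE => /eqP; rewrite scaler_eq0 (negPf x0) orbF => /eqP; left.
rewrite zE => /eqP; rewrite -subr_eq0 -{2}[x]scale1r -scalerBl scaler_eq0.
by rewrite (negPf x0) orbF subr_eq0 => /eqP; right.
Qed.

(** The fractional part of [a] times [x] is a lattice point of the segment from 0 to [x] other than
    [x], hence it is 0. *)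
Lemma primitive_int L B x a : lattice_basis L B -> primitive L x ->
  L (a *: x) -> a \is a Num.int.
Proof.
move=> bL Px Lax; have [Lx _ _] := Px; set n : rat := (Num.floor a)%:~R.
have /andP[n1 n2] := floor_itv a; rewrite -/n intrD -/n in n1 n2.
have Lr : L ((a - n) *: x).
  rewrite scalerBl; apply: (latticeB bL Lax).
  by apply: (latticeZ bL Lx); rewrite intr_int.
case: (primitive_scale01 Px Lr erefl); first by apply/andP; split; lra.
  by move=> h; have -> : a = n by [lra]; rewrite intr_int.
by move=> h; exfalso; lra.
Qed.

(** Both [a] and its inverse are integers by [primitive_int]. *)
Lemma primitive_parallel L B x y a : lattice_basis L B -> primitive L x ->
  primitive L y -> y = a *: x -> a = 1 \/ a = -1.
Proof.
move=> bL Px Py yE; have [[Lx _ _] [Ly y0 _]] := (Px, Py).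
have a0 : a != 0 by apply: contraNneq y0 => a0; rewrite yE a0 scale0r.
have xE : x = a^-1 *: y by rewrite yE scalerA mulVf ?scale1r.
have ia : a \is a Num.int by apply: (primitive_int bL Px); rewrite -yE.
have ib : a^-1 \is a Num.int by apply: (primitive_int bL Py); rewrite -xE.
have := norm_intr_ge1 ia a0; have := norm_intr_ge1 ib (invr_neq0 a0).
rewrite normfV => h1 h2.
have : `|a| <= 1 by rewrite -invf_ge1 // normr_gt0.
move=> h3; have /eqP : `|a| = 1 by lra.
by rewrite eqr_norml => /andP[/orP[]/eqP -> _]; [left|right].
Qed.
(** * The lattice generated by a loop *)

Lemma cyc_modD s i m : cyc s (i %% size s + m) = cyc s (i + m).
Proof. by rewrite /cyc modnDml. Qed.

Lemma cyc_addn s i : cyc s (i + size s) = cyc s i.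
Proof. by rewrite /cyc modnDr. Qed.

Lemma cyc_small s i : (i < size s)%N -> cyc s i = s`_i.
Proof. by move=> h; rewrite /cyc modn_small. Qed.

Lemma cyc_mem s i : s != [::] -> cyc s i \in s.
Proof. by move=> s0; apply: mem_nth; rewrite ltn_mod; case: s s0. Qed.

Lemma mem_cyc s x : x \in s -> exists2 i, (i < size s)%N & x = cyc s i.
Proof.
by move=> xs; exists (index x s); rewrite ?cyc_small ?nth_index ?index_mem.
Qed.

Lemma cyc_prevS s i : s != [::] -> cyc_prev s i.+1 = cyc s i.
Proof.
move=> s0; have n0 : (0 < size s)%N by case: s s0.
by rewrite /cyc_prev addSn -addnS prednK // cyc_addn.
Qed.

Lemma reflexive_loopP L l s : reflexive_loop L l s ->
  [/\ s != [::], forall i, cyc s i != 0 & exists2 B, lattice_basis L B &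
    forall i, [/\ L (cyc s i), primitive L (cyc s i.+1 - cyc s i),
      `|det_wrt B (cyc s i) (cyc s i.+1)| = l%:R
      & is_vertex s i -> primitive L (cyc s i)]].
Proof.
move=> [s0 Ls [B bL h]]; have n0 : (0 < size s)%N by case: (s) s0.
split=> // [i|]; first by case: (Ls (cyc s i)) => //; exact: cyc_mem.
exists B => // i; have /h : (i %% size s < size s)%N by rewrite ltn_mod.
have e : cyc s (i %% size s) = cyc s i by have := cyc_modD s i 0;
  rewrite !addn0.
have eS : cyc s (i %% size s).+1 = cyc s i.+1.
  by have := cyc_modD s i 1; rewrite !addn1.
rewrite /is_vertex /cyc_prev /cyc_next cyc_modD e eS => -[? ? ?].
by split=> //; case: (Ls (cyc s i)) => //; exact: cyc_mem.
Qed.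

(** Both differences are nonnegative multiples of [z - x]. Being primitive and parallel they agree
    up to sign, and the sign -1 is excluded. Thus a boundary point that is not a vertex is the
    midpoint of its neighbours. *)
Lemma in_segment_midpoint L B (x y z : point) : lattice_basis L B ->
  primitive L (y - x) -> primitive L (z - y) -> in_segment x z y ->
  z - y = y - x.
Proof.
move=> bL Pyx Pzy [a /andP[a0 a1] yE].
have yxE : y - x = a *: (z - x) by rewrite yE; apply/point_eqP; rewrite !mxE;
  split; ring.
have zyE : z - y = (1 - a) *: (z - x).
  by rewrite yE; apply/point_eqP; rewrite !mxE; split; ring.
have [_ yx0 _] := Pyx; have an0 : a != 0.
  by apply: contraNneq yx0 => h; rewrite yxE h scale0r.
have qE : z - y = ((1 - a) / a) *: (y - x) by rewrite zyE yxE scalerA divfK.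
have q0 : 0 <= (1 - a) / a by apply: divr_ge0; lra.
case: (primitive_parallel bL Pyx Pzy qE) => h; last by move: q0; rewrite h.
by rewrite qE h scale1r.
Qed.

Lemma loop_primitive_or_straight L l s i : reflexive_loop L l s ->
  primitive L (cyc s i.+1) \/
  cyc s i.+2 - cyc s i.+1 = cyc s i.+1 - cyc s i.
Proof.
move=> /reflexive_loopP[s0 _ [B bL h]].
case: (classic (is_vertex s i.+1)) => [v|/NNPP]; first by left;
  case: (h i.+1) => _ _ _; exact.
rewrite cyc_prevS // => seg; right.
by apply: (in_segment_midpoint bL) seg; [case: (h i)|case: (h i.+1)].
Qed.

(* Both determinants have absolute value l, so by Cramer's rule x_(i+2) and   *)
(* e x_i differ by a rational multiple of x_(i+1) with e = 1 or -1, and the   *)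
(* multiple is integral because x_(i+1) is primitive or a midpoint.           *)
Lemma loop_recurrence L l s i : (0 < l)%N -> reflexive_loop L l s ->
  exists m e : rat, [/\ m \is a Num.int, e \is a Num.int
    & cyc s i.+2 = e *: cyc s i + m *: cyc s i.+1].
Proof.
move=> l0 rs; case: (loop_primitive_or_straight i rs) => [Py|straight];
  last first.
  exists 2, (-1); rewrite rpredN; split => //.
  by rewrite -[LHS](subrK (cyc s i.+1)) straight; apply/point_eqP;
    rewrite !mxE; split; ring.
have [_ _ [B bL h]] := reflexive_loopP rs.
have [[Lx _ dxy _] [[Ly _ dyz _] [Lz _ _ _]]] := (h i, (h i.+1, h i.+2)).
move: (cyc s i) (cyc s i.+1) (cyc s i.+2) Py Lx dxy Ly dyz Lz => x y z Py Lx
  dxy Ly dyz Lz.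
have lR : (l%:R : rat) != 0 by rewrite pnatr_eq0 -lt0n.
have nz : det_wrt B x y != 0 by rewrite -normr_eq0 dxy.
have dB0 := lattice_basis_neq0 bL.
have nz2 : det2 x y != 0.
  by apply: contraNneq nz; rewrite det_wrtE => ->; rewrite mul0r.
set e := det2 z y / det2 x y.
have e1 : `|e| = 1.
  have -> : e = - (det_wrt B y z / det_wrt B x y).
    by rewrite /e !det_wrtE det2C; field; rewrite dB0.
  by rewrite normrN normf_div dxy dyz divff.
have ie : e \is a Num.int.
  by have /eqP := e1; rewrite eqr_norml => /andP[/orP[]/eqP -> _];
    rewrite ?rpredN.
have zE := det2_cramer z nz2; rewrite -/e in zE.
exists (det2 x z / det2 x y), e; split=> //.
apply: (primitive_int bL Py).
have -> : (det2 x z / det2 x y) *: y = z - e *: x by rewrite {2}zE addrC addKr.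
by apply: (latticeB bL Lz); apply: (latticeZ bL).
Qed.

Lemma generated_mem (s : seq point) x : x \in s -> generated_lattice s x.
Proof.
move=> xs; have h : (index x s < size s)%N by rewrite index_mem.
exists [ffun i => (i == Ordinal h)%:Z].
rewrite (bigD1 (Ordinal h)) //= ffunE eqxx nth_index // big1 ?addr0 // => i
  /negPf ih.
by rewrite ffunE ih.
Qed.

Lemma generated_min (s : seq point) L B : lattice_basis L B ->
  (forall x, x \in s -> L x) -> forall v, generated_lattice s v -> L v.
Proof.
move=> bL Ls v [a ->]; apply: (big_ind L) => [|x y|i _].
- exact: (lattice0 bL).
- exact: (latticeD bL).
 rewrite -scaler_int; apply: (latticeZ bL); rewrite ?intr_int //.
by apply/Ls/mem_nth; rewrite ltn_ord.
Qed.

Lemma span_lattice_basis x y : det2 x y != 0 ->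
  lattice_basis (fun v => exists a b, [/\ a \is a Num.int, b \is a Num.int
    & v = a *: x + b *: y]) (col_mx x y).
Proof.
move=> nz; split; first by rewrite unitmxE unitfE det_col_mx2.
move=> v; split=> [[a [b [ia ib ->]]]|[c ->]].
  exists (\row_j if j == 0 then Num.floor a else Num.floor b).
  rewrite mul_row2 !mxE /=; move: ia ib.
  by rewrite !intrEfloor => /eqP -> /eqP ->.
by exists (c 0 0)%:~R, (c 0 1)%:~R; rewrite !intr_int mul_row2 !mxE.
Qed.

Lemma eq_lattice_basis L L' B : (forall v, L v <-> L' v) ->
  lattice_basis L B -> lattice_basis L' B.
Proof. by move=> LL' [uB h]; split=> // v; rewrite -LL'. Qed.

Lemma loop_det_neq0 L l s i : (0 < l)%N -> reflexive_loop L l s ->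
  det2 (cyc s i) (cyc s i.+1) != 0.
Proof.
move=> l0 /reflexive_loopP[_ _ [B bL h]]; have [_ _ d _] := h i.
rewrite -normr_gt0 -(pmulr_lgt0 _ (x := `|(\det B)^-1|)); last first.
  by rewrite normr_gt0 invr_neq0 // (lattice_basis_neq0 bL).
by rewrite -normrM -det_wrtE d ltr0n.
Qed.

(** The recurrence reaches every point of the loop from the first two, with integral coefficients
    throughout. *)
Lemma generated_basis L l s : (0 < l)%N -> reflexive_loop L l s ->
  lattice_basis (generated_lattice s) (col_mx (cyc s 0) (cyc s 1)).
Proof.
move=> l0 rs; have [s0 _ _] := reflexive_loopP rs.
have bL := span_lattice_basis (loop_det_neq0 0 l0 rs).
apply: (eq_lattice_basis _ bL) => v; split.
  move=> [a [b [ia ib ->]]].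
  have closed c d : generated_lattice s c -> generated_lattice s d ->
      generated_lattice s (c + d).
    move=> [p ->] [q ->]; exists [ffun i => p i + q i]; rewrite -big_split /=.
    by apply: eq_bigr => i _; rewrite ffunE mulrzDr.
  have closedZ c x : c \is a Num.int -> generated_lattice s x ->
      generated_lattice s (c *: x).
    move=> /intrP[m ->] [p ->]; exists [ffun i => p i * m].
    by rewrite scaler_sumr; apply: eq_bigr => i _;
      rewrite ffunE scaler_int mulrzA.
  by apply: closed; apply: closedZ => //; apply/generated_mem/cyc_mem.
apply: (generated_min bL) => x /mem_cyc[i _ ->] {x}.
(* The recurrence has order two, so the induction carries two consecutive points. *)
suff : (exists a b, [/\ a \is a Num.int, b \is a Num.int
    & cyc s i = a *: cyc s 0 + b *: cyc s 1]) /\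
  (exists a b, [/\ a \is a Num.int, b \is a Num.int
    & cyc s i.+1 = a *: cyc s 0 + b *: cyc s 1]) by case.
elim: i => [|i [IH1 IH2]].
  by split; [exists 1, 0|exists 0, 1]; rewrite scale1r scale0r ?addr0 ?add0r.
split=> //; have [m [e [im ie ->]]] := loop_recurrence i l0 rs.
exact: (lattice_comb bL).
Qed.

Lemma primitive_sublattice (L L' : lattice) x : (forall v, L' v -> L v) ->
  L' x ->
  primitive L x -> primitive L' x.
Proof. by move=> sub L'x [_ x0 Px]; split=> // z /sub; exact: Px. Qed.

Lemma generated_reflexive L l s : (0 < l)%N -> reflexive_loop L l s ->
  reflexive_loop (generated_lattice s) 1 s.
Proof.
move=> l0 rs; have bG := generated_basis l0 rs.
have [s0 nz0 [B bL h]] := reflexive_loopP rs.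
have sub : forall v, generated_lattice s v -> L v.
  by apply: (generated_min bL) => x /mem_cyc[i _ ->]; case: (h i).
have Gs i : generated_lattice s (cyc s i) by apply/generated_mem/cyc_mem.
split=> //.
  by move=> x xs; split; [exact: generated_mem|case/mem_cyc: xs => i _ ->].
exists (col_mx (cyc s 0) (cyc s 1)) => // i _; have [_ Pd d Pv] := h i.
split; last by move/Pv; apply: primitive_sublattice.
  by apply: primitive_sublattice Pd => //; apply: (latticeB bG).
have [_ _ d0 _] := h 0%N; have dB0 := lattice_basis_neq0 bL.
(* Both bases measure the same determinant up to a constant factor, which the pair x_0, x_1
   fixes. *)
have e : det_wrt (col_mx (cyc s 0) (cyc s 1)) (cyc s i) (cyc_next s i) =
    det_wrt B (cyc s i) (cyc_next s i) / det_wrt B (cyc s 0) (cyc s 1).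
  rewrite !det_wrtE det_col_mx2; field.
  by rewrite dB0 (loop_det_neq0 0 l0 rs).
by rewrite e normf_div d d0 divff // pnatr_eq0 -lt0n.
Qed.
(** * Dual lattices and outer normals *)

Lemma dual_basis L B : lattice_basis L B ->
  lattice_basis (dual_lattice L) (invmx B)^T.
Proof.
move=> bL; have [uB LB] := bL; split; first by rewrite unitmx_tr unitmx_inv.
move=> u; split=> [h|[c ->] v /LB[d ->]]; last first.
  rewrite /pairing trmx_mul mulmxA -(mulmxA _ _ B^T) -trmx_mul mulmxV //.
  rewrite trmx1 mulmx1 !mxE rpred_sum // => i _.
  by rewrite !mxE rpredM // intr_int.
(* The coordinates of [u] in the dual basis are its pairings with the rows of [B]; they are
   integers, and the floor only changes their type. *)
exists (\row_j Num.floor (pairing u (row j B))).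
have -> : map_mx intr (\row_j Num.floor (pairing u (row j B))) = u *m B^T.
  apply/rowP => j; rewrite !mxE; have := h _ (lattice_basis_row j bL).
  rewrite intrEfloor => /eqP ->; rewrite /pairing !mxE.
  by apply: eq_bigr => i _; rewrite !mxE.
by rewrite -mulmxA -trmx_mul mulVmx // trmx1 mulmx1.
Qed.

(* A rescaled quarter turn: it maps the lattice with basis B onto its dual.   *)
Definition rho (B : 'M[rat]_2) (w : point) : point :=
  (\det B)^-1 *: \row_j (if j == 0 then - w 0 1 else w 0 0).

Lemma rhoE B w : rho B w 0 0 = - w 0 1 / \det B /\ rho B w 0 1 = w 0 0 / \det B.
Proof. by rewrite !mxE /=; split; rewrite mulrC. Qed.

Lemma pairing_rho B w v : pairing (rho B w) v = det_wrt B w v.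
Proof.
have [e0 e1] := rhoE B w.
by rewrite pairingE e0 e1 det_wrtE /det2; ring.
Qed.

Lemma det2_rho B u x : det2 u (rho B x) = pairing u x / \det B.
Proof. by have [e0 e1] := rhoE B x; rewrite /det2 e0 e1 pairingE; ring. Qed.

Lemma scale_pointE a (x : point) j : (a *: x) 0 j = a * x 0 j.
Proof. by rewrite mxE. Qed.

Lemma rhoZ B a x : rho B (a *: x) = a *: rho B x.
Proof.
have [[e0 e1] [f0 f1]] := (rhoE B x, rhoE B (a *: x)); apply/point_eqP.
by rewrite f0 f1 !(scale_pointE a) e0 e1; split; ring.
Qed.

Lemma dual_rho L B w : lattice_basis L B -> (dual_lattice L (rho B w) <-> L w).
Proof.
move=> bL; split=> [h|Lw v Lv]; last by rewrite pairing_rho;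
  exact: det_wrt_int bL Lw Lv.
by apply: (lattice_det_int bL) => v Lv; rewrite -pairing_rho; exact: h.
Qed.

Lemma rho_eq0 L B w : lattice_basis L B -> (rho B w == 0) = (w == 0).
Proof.
move=> /lattice_basis_neq0 dB; apply/eqP/eqP => [|->]; last first.
  by have := rhoZ B 0 0; rewrite !scale0r.
have [e0 e1] := rhoE B w; move/point_eqP; rewrite e0 e1 !mxE => -[/eqP + /eqP].
rewrite !mulf_eq0 invr_eq0 (negPf dB) !orbF oppr_eq0 => /eqP w1 /eqP w0.
by apply/point_eqP; rewrite !mxE.
Qed.

(** The points orthogonal to a nonzero [x] form a line, spanned by the quarter turn of [x]; the
    factor is read off at a nonzero coordinate of [x]. *)
Lemma orthogonal_rho L B u x : lattice_basis L B -> x != 0 ->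
  pairing u x = 0 -> exists q, u = q *: rho B x.
Proof.
move=> /lattice_basis_neq0 dB x0; rewrite pairingE => ux.
have [e0 e1] := rhoE B x.
have [x00|x00] := eqVneq (x 0 0) 0.
  have x01 : x 0 1 != 0.
    by apply: contraNneq x0 => x01; apply/eqP/point_eqP; rewrite !mxE.
  exists (- u 0 0 * \det B / x 0 1); apply/point_eqP;
    rewrite !(scale_pointE _ (rho B x)) e0 e1.
  split; first by field; rewrite dB.
  apply: (mulIf x01); rewrite x00 in ux *; rewrite mul0r mulr0 mul0r; lra.
exists (u 0 1 * \det B / x 0 0); apply/point_eqP;
  rewrite !(scale_pointE _ (rho B x)) e0 e1.
split; last by field; rewrite dB.
apply: (mulIf x00); have -> : u 0 0 * x 0 0 = - (u 0 1 * x 0 1) by lra.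
by field; rewrite dB.
Qed.

Lemma in_segment0 x z : in_segment 0 x z <->
  exists2 a, 0 <= a <= 1 & z = a *: x.
Proof. by split=> -[a a01 ->]; exists a; rewrite // scaler0 add0r. Qed.

Lemma primitive_rho L B x : lattice_basis L B -> primitive L x ->
  primitive (dual_lattice L) (rho B x).
Proof.
move=> bL Px; have [Lx x0 _] := Px; split; first by apply/dual_rho.
  by rewrite (rho_eq0 _ bL).
move=> z Lz /in_segment0[a a01 zE]; move: Lz;
  rewrite zE -rhoZ => /(dual_rho _ bL) Lax.
by case: (primitive_scale01 Px Lax erefl a01) => ->;
  rewrite rhoZ ?scale0r ?scale1r; auto.
Qed.

Lemma primitiveN L B x : lattice_basis L B -> primitive L x ->
  primitive L (- x).
Proof.
have LN v : lattice_basis L B -> L v -> L (- v).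
  by move=> bL Lv; rewrite -sub0r; apply: (latticeB bL) (lattice0 bL) Lv.
move=> bL [Lx x0 Px]; split; rewrite ?oppr_eq0 //; first exact: LN.
move=> z Lz /in_segment0[a a01 zE].
case: (Px (- z)); [exact: LN|by apply/in_segment0; exists a;
  rewrite // zE scalerN opprK| |].
  by move/eqP; rewrite oppr_eq0 => /eqP; left.
by move=> <-; rewrite opprK; right.
Qed.

Lemma in_segment_pairing (u v z x : point) (c : rat) : in_segment u v z ->
  pairing u x = c -> pairing v x = c -> pairing z x = c.
Proof.
by move=> [a _ ->] ux vx; rewrite pairingDl !pairingZl ux vx; ring.
Qed.

(** The quarter turn of the edge direction is primitive and pairs with both ends to the same value,
    plus or minus l; the sign of the determinant decides which orientation of the edge to turn. *)
Lemma outer_normal_exists L B l x y : lattice_basis L B -> L x -> L y ->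
  primitive L (y - x) -> `|det_wrt B x y| = l%:R ->
  exists u, outer_normal L l x y u.
Proof.
move=> bL Lx Ly Pd.
have [e0 e1] : det_wrt B (y - x) x = - det_wrt B x y /\
    det_wrt B (y - x) y = - det_wrt B x y.
  by rewrite !det_wrtE /det2 !mxE; split; ring.
have Pd' : primitive L (x - y) by rewrite -opprB; apply: (primitiveN bL).
have E z : det_wrt B (x - y) z = - det_wrt B (y - x) z.
  by rewrite !det_wrtE /det2 !mxE; ring.
case: (lerP 0 (det_wrt B x y)) => [s|s].
  move=> d; exists (rho B (x - y)); split; first exact: primitive_rho.
    by rewrite pairing_rho E e0 opprK -d ger0_norm.
  by rewrite pairing_rho E e1 opprK -d ger0_norm.
move=> d; exists (rho B (y - x)); split; first exact: primitive_rho.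
  by rewrite pairing_rho e0 -d ltr0_norm.
by rewrite pairing_rho e1 -d ltr0_norm.
Qed.

(** Cramer's rule for the functionals [u] and [v]; this is what makes outer normals unique. *)
Lemma pairing_inj (x y u v : point) : det2 x y != 0 ->
  pairing u x = pairing v x -> pairing u y = pairing v y -> u = v.
Proof.
rewrite /det2 !pairingE => nz ex ey; apply/point_eqP; split.
  apply: (mulIf nz).
  transitivity ((u 0 0 * x 0 0 + u 0 1 * x 0 1) * y 0 1 -
                (u 0 0 * y 0 0 + u 0 1 * y 0 1) * x 0 1); first ring.
  by rewrite ex ey; ring.
apply: (mulIf nz).
transitivity ((u 0 0 * y 0 0 + u 0 1 * y 0 1) * x 0 0 -
              (u 0 0 * x 0 0 + u 0 1 * x 0 1) * y 0 0); first ring.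
by rewrite ex ey; ring.
Qed.

(** * Lattice points on a segment *)

Lemma in_segment_param (u v z : point) : in_segment u v z <->
  exists2 a, 0 <= a <= 1 & z = u + a *: (v - u).
Proof.
by split=> -[a a01 ->]; exists a => //; apply/point_eqP; rewrite !mxE; split;
  ring.
Qed.

Lemma param_inj (u v : point) : u != v -> injective (fun a => u + a *: (v - u)).
Proof.
move=> uv a b /addrI /eqP; rewrite -subr_eq0 -scalerBl scaler_eq0.
by rewrite !subr_eq0 [v == u]eq_sym (negPf uv) orbF => /eqP.
Qed.

Lemma traverses_unique L u v p p' :
  traverses L u v p -> traverses L u v p' -> p = p'.
Proof.
move=> [Up Mp [a sa pE]] [Up' Mp' [a' sa' pE']].
have pp : perm_eq p p'.
  by apply: uniq_perm => // z; apply/idP/idP => [/Mp/Mp'|/Mp'/Mp].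
rewrite pE pE'; have [uv|uv] := eqVneq u v.
  have cst b : [seq u + r *: (v - u) | r <- b] = nseq (size b) u.
    by rewrite uv subrr; elim: b => //= r b ->; rewrite scaler0 addr0.
  by have := perm_size pp; rewrite pE pE' !cst !size_nseq => ->.
congr map; apply: le_sorted_eq => //.
by apply: (perm_map_inj (param_inj uv)); rewrite -pE -pE'.
Qed.

Lemma traverses_point (L : lattice) u : L u -> traverses L u u [:: u].
Proof.
move=> Lu; split=> // [z|]; last by exists [:: 0]; rewrite //= scale0r addr0.
rewrite inE; split=> [/eqP ->|[_ /in_segment_param[r _ ->]]].
  by split=> //; apply/in_segment_param; exists 0;
    rewrite ?lexx ?ler01 ?scale0r ?addr0.
by rewrite subrr scaler0 addr0.
Qed.

(** The working form of [traverses]: off the degenerate case, the parameters are strictly sorted and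
    are exactly the admissible ones. *)
Lemma traverses_shape L u v p : L u -> L v -> traverses L u v p ->
  (u = v /\ p = [:: u]) \/
  exists a : seq rat, [/\ u != v, sorted <%O a,
    forall r, r \in a <-> 0 <= r <= 1 /\ L (u + r *: (v - u))
    & p = [seq u + r *: (v - u) | r <- a]].
Proof.
move=> Lu Lv tp; have [uv|uv] := eqVneq u v; [left|right].
  by split=> //; apply: traverses_unique tp _; rewrite -uv;
    exact: traverses_point.
case: tp => Up Mp [a sa pE]; exists a; split=> //.
  by rewrite lt_sorted_uniq_le sa andbT; move: Up; rewrite pE => /map_uniq.
move=> r; rewrite -(mem_map (param_inj uv)) -pE Mp;
  split=> [[Lz /in_segment_param[b b01]]|[r01 Lz]].
  by move/(param_inj uv) => rb; rewrite rb in Lz *.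
by split=> //; apply/in_segment_param; exists r.
Qed.

Lemma traverses_ends L u v p : L u -> L v -> traverses L u v p ->
  [/\ (0 < size p)%N, p`_0 = u & p`_(size p).-1 = v].
Proof.
move=> Lu Lv /(traverses_shape Lu Lv)[[<- ->] //|[a [uv sa Ma pE]]].
have a0 : 0 \in a by apply/Ma; rewrite scale0r addr0 lexx ler01.
have a1 : 1 \in a by apply/Ma; rewrite scale1r addrC subrK lexx ler01.
have na : (0 < size a)%N by case: (a) a0.
have sa' : sorted <=%O a by move: sa; rewrite lt_sorted_uniq_le => /andP[].
have bnd i : (i < size a)%N -> 0 <= a`_i <= 1 by move=> h;
  case/Ma: (mem_nth 0 h).
have mono i j : (i <= j)%N -> (j < size a)%N -> a`_i <= a`_j.
  by move=> ij ja; apply: (sorted_leq_nth le_trans le_refl _ sa') => //;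
    rewrite inE ?(leq_ltn_trans ij).
have e0 : a`_0 = 0.
  apply/eqP; rewrite eq_le (andP (bnd _ na)).1 andbT.
  have := mono 0%N (index 0 a) (leq0n _); rewrite index_mem nth_index //; exact.
have e1 : a`_(size a).-1 = 1.
  have l1 : ((size a).-1 < size a)%N by rewrite prednK.
  apply/eqP; rewrite eq_le (andP (bnd _ l1)).2 /=.
  have := mono (index 1 a) (size a).-1; rewrite nth_index //; apply=> //.
  by rewrite -ltnS prednK // index_mem.
rewrite pE size_map; split; rewrite ?(nth_map 0) ?prednK //.
  by rewrite e0 scale0r addr0.
by rewrite e1 scale1r addrC subrK.
Qed.

(** A lattice point inside the step, translated by the point at [c], would be a lattice point of the
    segment with a parameter strictly between two successive entries of the sorted list. *)
Lemma traverses_step_primitive L B u v p c : lattice_basis L B -> L u -> L v ->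
  traverses L u v p -> (c.+1 < size p)%N -> u != v /\
    primitive L (p`_c.+1 - p`_c).
Proof.
move=> bL Lu Lv /(traverses_shape Lu Lv)[[_ ->] //|[a [uv sa Ma pE]]] hc;
  split=> //.
rewrite pE size_map in hc; have hc' := ltnW hc.
have lt_c : a`_c < a`_c.+1 by apply: (sorted_ltn_nth lt_trans) => //.
have sa' : sorted <=%O a by move: sa; rewrite lt_sorted_uniq_le => /andP[].
have [/andP[c0 c1] Lc] := (Ma _).1 (mem_nth 0 hc').
have [/andP[d0 d1] Ld] := (Ma _).1 (mem_nth 0 hc).
have dE : p`_c.+1 - p`_c = (a`_c.+1 - a`_c) *: (v - u).
  by rewrite pE !(nth_map 0) // scalerBl opprD addrACA subrr add0r.
have Ldiff : L (p`_c.+1 - p`_c) by rewrite pE !(nth_map 0) //;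
  apply: (latticeB bL).
split=> //; first by rewrite dE scaler_eq0 !subr_eq0 negb_or eq_sym (lt_eqF
  lt_c) eq_sym.
move=> z Lz /in_segment0[t /andP[t0 t1] zE]; rewrite dE scalerA in zE.
(* The parameter of the point at [c] translated by [z]. *)
set w := a`_c + t * (a`_c.+1 - a`_c).
have dp : 0 <= a`_c.+1 - a`_c by rewrite subr_ge0 ltW.
have tp : 0 <= t * (a`_c.+1 - a`_c) by apply: mulr_ge0.
have tp1 : t * (a`_c.+1 - a`_c) <= a`_c.+1 - a`_c by apply: ler_piMl.
have wa : w \in a.
  apply/Ma; split; first by apply/andP; rewrite /w; split; lra.
  by rewrite /w scalerDl addrA -zE; apply: (latticeD bL).
have : w = a`_c \/ w = a`_c.+1.
  have iw := wa; rewrite -index_mem in iw; have wE := nth_index 0 wa.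
  have mono i j : (i <= j)%N -> (j < size a)%N -> a`_i <= a`_j.
    by move=> ij ja; apply: (sorted_leq_nth le_trans le_refl _ sa') => //;
      rewrite inE ?(leq_ltn_trans ij).
  have [le|gt] := leqP (index w a) c.
    left; have := mono _ _ le hc'; rewrite wE /w; lra.
  right; have := mono _ _ gt iw; rewrite wE /w; lra.
rewrite dE zE => -[wE|wE]; [left|right].
  by have -> : t * (a`_c.+1 - a`_c) = 0 by [rewrite /w in wE; lra];
    rewrite scale0r.
by congr (_ *: _); rewrite /w in wE; lra.
Qed.

Lemma traverses_interior L u v p c : L u -> L v ->
  traverses L u v p -> (c.+2 < size p)%N -> in_segment p`_c p`_c.+2 p`_c.+1.
Proof.
move=> Lu Lv /(traverses_shape Lu Lv)[[_ ->] //|[a [uv sa Ma pE]]] hc.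
rewrite pE size_map in hc *;
  rewrite !(nth_map 0) ?(ltnW hc) ?(ltnW (ltnW hc)) //.
have lt1 : a`_c < a`_c.+1.
  by apply: (sorted_ltn_nth lt_trans);
    rewrite ?inE // ?(ltnW hc) // (ltnW (ltnW hc)).
have lt2 : a`_c.+1 < a`_c.+2 by apply: (sorted_ltn_nth lt_trans);
  rewrite ?inE // (ltnW hc).
move: (a`_c) (a`_c.+1) (a`_c.+2) lt1 lt2 => r s t rs st.
have tr : 0 < t - r by lra.
apply/in_segment_param; exists ((s - r) / (t - r)).
  by rewrite divr_ge0 ?ler_pdivrMr //=; lra.
have tr0 : t - r != 0 by rewrite gt_eqF.
by apply/point_eqP; rewrite !mxE; split; field.
Qed.

(** Some coordinate of [v - u] in the basis [B] has absolute value n > 0. A lattice point with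
    parameter r makes r n an integer, so only the finitely many fractions k / n with k at most n
    need to be tested. *)
Lemma traverses_exists L B u v : lattice_basis L B -> L u -> L v ->
  exists p, traverses L u v p.
Proof.
move=> bL Lu Lv; have [uv|uv] := eqVneq u v.
  by exists [:: u]; rewrite -uv; exact: traverses_point.
have Lw : L (v - u) by apply: (latticeB bL).
have uB : B \in unitmx by case: bL.
pose c := (v - u) *m invmx B.
have [j cj] : exists j, c 0 j != 0.
  apply/existsP/contraT; rewrite negb_exists => /forallP h.
  have : c = 0 by apply/rowP => j; rewrite [RHS]mxE; apply/eqP/negbNE/h.
  move/(congr1 (mulmx^~ B)); rewrite /c mulmxKV // mul0mx => /eqP.
  by rewrite subr_eq0 eq_sym (negPf uv).
have [n nE] : exists n : nat, `|c 0 j| = n%:R.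
  have := (lattice_basisP bL _).1 Lw j;
    rewrite -/c => /natr_norm_int/natrP[n ->].
  by exists n.
have n0 : (0 : rat) < n%:R by rewrite -nE normr_gt0.
(* A boolean form of membership in [L], needed to filter the candidates. *)
pose inL (r : rat) := [forall i,
  ((u + r *: (v - u)) *m invmx B) 0 i \is a Num.int].
have inLP r : reflect (L (u + r *: (v - u))) (inL r).
  by apply: (iffP forallP) => h;
    [apply/(lattice_basisP bL)|exact/(lattice_basisP bL)].
pose a := [seq r <- [seq k%:R / n%:R | k <- iota 0 n.+1] | inL r].
have sa : sorted <%O a.
  apply: sorted_filter; first exact: lt_trans.
  rewrite sorted_map; apply: sub_sorted (iota_ltn_sorted 0 n.+1) => i k ik /=.
  by rewrite ltr_pM2r ?invr_gt0 // ltr_nat.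
exists [seq u + r *: (v - u) | r <- a].
have sa' := sa; rewrite lt_sorted_uniq_le in sa'; case/andP: sa' => ua sa'.
split; [by rewrite (map_inj_uniq (param_inj uv))| |by exists a].
move=> z; split.
  move=> /mapP[r]; rewrite mem_filter => /andP[/inLP Lr /mapP[k]].
  rewrite mem_iota add0n ltnS /= => kn rE ->; split=> //.
  apply/in_segment_param; exists r => //; rewrite rE divr_ge0 ?ler0n //=.
  by rewrite ler_pdivrMr // mul1r ler_nat.
move=> [Lz /in_segment_param[r /andP[r0 r1] zE]]; rewrite zE in Lz *.
apply: map_f; rewrite mem_filter; apply/andP; split; first exact/inLP.
have : L (r *: (v - u)).
  by rewrite -[r *: _](addKr u) addrC; apply: (latticeB bL).
move/(lattice_basisP bL)/(_ j);
  rewrite -scalemxAl mxE -/c => /natr_norm_int/natrP[k].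
rewrite normrM nE ger0_norm // => kE.
have rE : r = k%:R / n%:R by rewrite -kE mulfK // gt_eqF.
rewrite rE; apply/mapP; exists k => //; rewrite mem_iota add0n ltnS /=.
by rewrite -(ler_nat rat) -kE ler_piMl // ltW.
Qed.
(** * Omitting repetitions in a cyclic list *)

(** [J] lists the indices satisfying [R] within one period, and [idx] continues this list through
    all later periods. It enumerates the indices satisfying [R] from its first value on,
    increasingly and without gaps, so that cyclic wraparound disappears. *)
Lemma periodic_enum (R : pred nat) n (J := filter R (iota 0 n))
    (idx := fun k => (nth 0%N J (k %% size J) + k %/ size J * n)%N) :
  (forall i, R (i + n)%N = R i) -> has R (iota 0 n) ->
  forall k, [/\ R (idx k), (idx k < idx k.+1)%N
    & forall i, (idx k < i < idx k.+1)%N -> ~~ R i].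
Proof.
move=> Rn hR k; have m0 : (0 < size J)%N by rewrite size_filter -has_count.
have RnM i q : R (i + q * n)%N = R i.
  by elim: q => [|q IH]; rewrite ?addn0 // mulSnr addnA Rn.
have sJ : sorted ltn J by apply: (sorted_filter ltn_trans);
  exact: iota_ltn_sorted.
have JP a : (a < size J)%N -> R (nth 0%N J a) && (nth 0%N J a < n)%N.
  by move=> /(mem_nth 0%N); rewrite mem_filter mem_iota add0n.
have Jlt a b : (a < b)%N -> (b < size J)%N -> (nth 0%N J a < nth 0%N J b)%N.
  by move=> ab bm; apply: (sorted_ltn_nth ltn_trans) => //;
    rewrite inE (ltn_trans ab).
have cm : (k %% size J < size J)%N by rewrite ltn_mod.
(* The next index is in the same period, or is the first one of the following period. *)
have idxS : idx k.+1 = if ((k %% size J).+1 < size J)%N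
    then (nth 0%N J (k %% size J).+1 + k %/ size J * n)%N
    else (nth 0%N J 0 + (k %/ size J).+1 * n)%N.
  rewrite {1}/idx; have -> : k.+1 = (k %/ size J * size J + (k %% size J).+1)%N.
    by rewrite addnS -divn_eq.
  rewrite modnMDl divnMDl //.
  case: ltnP => h; first by rewrite (modn_small h) (divn_small h) addn0.
  have -> : (k %% size J).+1 = size J by apply/eqP; rewrite eqn_leq cm.
  by rewrite modnn divnn m0 addn1.
rewrite idxS /idx; move: (k %% size J)%N (k %/ size J)%N cm => c b cm.
have /andP[Rc cn] := JP c cm; have /andP[_ n_0] := JP 0%N m0.
split; first by rewrite RnM.
  by case: ifP => [/(Jlt c c.+1 (leqnn _))|_]; nia.
(* An index satisfying [R] in the gap would be q n + J_a; comparing q with the period and a with the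
   position of [idx k] leaves no room for it. *)
move=> i hi; apply/negP => Ri.
have n0 : (0 < n)%N by apply: leq_ltn_trans cn.
have iJ : (i %% n)%N \in J.
  by rewrite mem_filter mem_iota ltn_mod n0 -(RnM _ (i %/ n)%N) addnC -divn_eq
    Ri.
have aE : nth 0%N J (index (i %% n)%N J) = (i %% n)%N :> nat
  by exact: nth_index.
rewrite -index_mem in iJ.
move: (divn_eq i n) aE iJ;
  move: (i %/ n)%N (i %% n)%N (index _ _) => q r a iE aE am.
have /andP[_ rn] := JP a am; rewrite aE in rn.
have qb : (b <= q)%N by case: leqP => // qb; move: hi; rewrite iE;
  case: ifP => _; nia.
case/andP: hi => lo; case: (ltnP c.+1 (size J)) => h hi.
  have /andP[_ Jc1] := JP _ h; have qE : q = b by nia.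
  subst q i; have ca : (c < a)%N.
    have [//|ac|ac] := ltngtP c a; last by rewrite -ac in aE; lia.
    by have := Jlt _ _ ac cm; lia.
  have [ac|ac] := eqVneq a c.+1; first by rewrite ac in aE; lia.
  have lt : (c.+1 < a)%N by lia.
  by have := Jlt _ _ lt am; lia.
have [qE|qE] := eqVneq q b.
  subst q i; have ca : (a <= c)%N by rewrite -ltnS (leq_trans am).
  have [ac|ac] := eqVneq a c; first by rewrite ac in aE; lia.
  have lt : (a < c)%N by lia.
  by have := Jlt _ _ lt cm; lia.
have qE' : q = b.+1 by nia.
subst q i; have [a0|a0] := posnP a; first by rewrite a0 in aE; lia.
by have := Jlt _ _ a0 am; lia.
Qed.

(** The kept indices are those where the value differs from the preceding one; unrolled by
    [periodic_enum], the sequence is constant from each kept index up to the next. *)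
Lemma omit_repeats_steps (s : seq point) : ~~ constant s ->
  omit_repeats s != [::] /\
  exists idx : nat -> nat, forall k,
    [/\ (idx k < idx k.+1)%N, cyc (omit_repeats s) k = cyc s (idx k),
      cyc s (idx k) != cyc s (idx k.+1)
      & forall i, (idx k <= i < idx k.+1)%N -> cyc s i = cyc s (idx k)].
Proof.
move=> ncs; rewrite /omit_repeats (negPf ncs).
have s0 : s != [::] by apply: contraNneq ncs => ->.
have n0 : (0 < size s)%N by case: (s) s0.
pose R i := cyc s i != cyc_prev s i.
have Rn i : R (i + size s)%N = R i.
  by rewrite /R /cyc_prev addnAC !cyc_addn.
have hR : has R (iota 0 (size s)).
  apply: contraNT ncs => /hasPn hR; apply/(constantP (0 : point));
    exists (cyc s 0).
  suff E i : cyc s i = cyc s 0.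
    apply: (@eq_from_nth _ (0 : point)) => [|i hi]; first by rewrite size_nseq.
    by rewrite nth_nseq hi -cyc_small.
  elim: i => // i <-; rewrite -(cyc_prevS i s0); apply/eqP.
  have : (i.+1 %% size s)%N \in iota 0 (size s) by rewrite mem_iota ltn_mod.
  move/hR; rewrite /R negbK /cyc_prev cyc_modD.
  by have := cyc_modD s i.+1 0; rewrite !addn0 => ->.
set J := filter R _.
have m0 : (0 < size J)%N by rewrite size_filter -has_count.
pose idx k := (nth 0%N J (k %% size J) + k %/ size J * size s)%N.
have enumP : forall k, [/\ R (idx k), (idx k < idx k.+1)%N
    & forall i, (idx k < i < idx k.+1)%N -> ~~ R i] := periodic_enum Rn hR.
split.
  by rewrite -size_eq0 size_map -lt0n.
exists idx => k; have [Rk lt_k gap] := enumP k; have [RSk _ _] := enumP k.+1.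
have stay i : (idx k <= i < idx k.+1)%N -> cyc s i = cyc s (idx k).
  elim: i => [|i IH] /andP[lo hi]; first by congr cyc; lia.
  have [->//|ne] := eqVneq (idx k) i.+1.
  rewrite -IH; last by lia.
  have /negbNE/eqP -> : ~~ R i.+1 by apply: gap; lia.
  by rewrite cyc_prevS.
split=> //.
  rewrite {1}/cyc size_map (nth_map 0%N) ?ltn_mod // /idx.
  elim: (k %/ _)%N => [|q IH]; first by rewrite addn0.
  by rewrite mulSnr addnA cyc_addn.
move: RSk lt_k stay; rewrite /R; case: (idx k.+1) => // i + lt_k stay.
by rewrite cyc_prevS // eq_sym (stay i) // -ltnS lt_k ltnSn.
Qed.

(** Locates a cyclic index of the concatenation as offset [c] in block [i]. Blocks being nonempty,
    the last point of a block is followed by the first point of the next one, also around the end of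
    the list. *)
Lemma cyc_flatten (ps : seq (seq point)) j :
  (0 < size ps)%N ->
  (forall i, (i < size ps)%N -> (0 < size (nth [::] ps i))%N) ->
  exists i c, [/\ (i < size ps)%N, (c < size (nth [::] ps i))%N,
    forall e, (c + e < size (nth [::] ps i))%N ->
      cyc (flatten ps) (j + e) = (nth [::] ps i)`_(c + e)
    & c.+1 = size (nth [::] ps i) ->
      cyc (flatten ps) j.+1 = (nth [::] ps (i.+1 %% size ps))`_0].
Proof.
move=> t0 ne; set s := flatten ps; pose pos i := sumn (take i (shape ps)).
have posS i : (i < size ps)%N -> pos i.+1 = (pos i + size (nth [::] ps i))%N.
  move=> hi; rewrite /pos (take_nth 0%N) ?size_map // sumn_rcons.
  by rewrite (nth_map [::]).
have nth_pos i c : (i < size ps)%N -> (c < size (nth [::] ps i))%N ->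
    (pos i + c < size s)%N /\ s`_(pos i + c) = (nth [::] ps i)`_c.
  move=> hi hc; have hc' : (c < nth 0%N (shape ps) i)%N
    by rewrite (nth_map [::]).
  rewrite size_flatten (flatten_indexP hc') nth_flatten.
  by rewrite (flatten_indexKl hc') (flatten_indexKr hc').
have s0 : (0 < size s)%N.
  by case: (nth_pos 0%N 0%N t0 (ne _ t0)) => h _; apply: leq_ltn_trans h.
have jn : (j %% size s < sumn (shape ps))%N by rewrite -size_flatten ltn_mod.
have hi := reshape_indexP jn; have hc := reshape_offsetP jn.
have jE := reshape_indexK (shape ps) (j %% size s).
move: (reshape_index _ _) (reshape_offset _ _) hi hc jE => i c.
rewrite size_map => hi; rewrite (nth_map [::]) // => hc jE.
have cycE e : cyc s (j + e) = cyc s (pos i + c + e).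
  by rewrite -cyc_modD -jE.
exists i, c; split=> // [e he|ce].
  have [lt E] := nth_pos i (c + e)%N hi he.
  by rewrite cycE -addnA cyc_small.
rewrite -addn1 cycE -addnA addn1 ce -posS //.
have [hi'|hi'] := ltnP i.+1 (size ps).
  have [lt E] := nth_pos i.+1 0%N hi' (ne _ hi').
  by rewrite modn_small // -E addn0 in lt *; rewrite cyc_small.
have iE : i.+1 = size ps by apply/eqP; rewrite eqn_leq hi.
have [lt E] := nth_pos 0%N 0%N t0 (ne _ t0).
(* After the last block the position is the full length, which [cyc] identifies with 0. *)
rewrite iE modnn -E /pos -(size_map size ps) take_size -size_flatten.
by rewrite -[size _]add0n cyc_addn take0 cyc_small.
Qed.
(** * The dual loop *)

(** Finite choice by induction; it assembles the lists of normals and of segment points that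
    [dual_loop] asks for. *)
Lemma list_choice (T : Type) (x0 : T) (Q : nat -> T -> Prop) n :
  (forall i, (i < n)%N -> exists y, Q i y) ->
  exists2 s, size s = n & forall i, (i < n)%N -> Q i (nth x0 s i).
Proof.
elim: n => [|n IH] h; first by exists [::].
have [i hi|s sn sQ] := IH; first by apply: h; exact: ltnW.
have [y Qy] := h n (ltnSn n); exists (rcons s y);
  first by rewrite size_rcons sn.
move=> i; rewrite ltnS leq_eqVlt nth_rcons sn => /predU1P[->|hi].
  by rewrite ltnn eqxx.
by rewrite hi; exact: sQ.
Qed.

Lemma dual_loop_exists L l s : reflexive_loop L l s ->
  exists d, dual_loop L l s d.
Proof.
move=> /reflexive_loopP[s0 _ [B bL h]].
have [i _|u su uP] := list_choice (0 : point) (n := size s)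
    (Q := fun i => outer_normal L l (cyc s i) (cyc_next s i)).
  have [[Lx Pd d _] [Ly _ _ _]] := (h i, h i.+1).
  exact: (outer_normal_exists bL).
have n0 : (0 < size s)%N by case: (s) s0.
have uL i : dual_lattice L (cyc u i).
  by rewrite /cyc; case: (uP (i %% size u)%N) => [|[]//]; rewrite su ltn_mod.
have [i _|ps sps psP] := list_choice ([::] : seq point) (n := size s)
    (Q := fun i => traverses (dual_lattice L) (cyc u i) (cyc_next u i)).
  exact: traverses_exists (dual_basis bL) (uL i) (uL i.+1).
exists (omit_repeats (flatten ps)), u, ps; split=> // i hi.
by rewrite (cyc_small (s := u)) ?su //; exact: uP.
Qed.

Lemma pairingC u v : pairing u v = pairing v u.
Proof. by rewrite !pairingE; ring. Qed.

Lemma det_dual_basis (B : 'M[rat]_2) : \det ((invmx B)^T) = (\det B)^-1.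
Proof. by rewrite det_tr det_inv. Qed.

(** If the loop went straight through x_(i+1), then x_(i+2) = 2 x_(i+1) - x_i would also pair to [c]
    with [u], so [u] and [v] would agree on two independent points. *)
Lemma distinct_normals_primitive L l s i u v (c : rat) :
  (0 < l)%N -> reflexive_loop L l s -> u != v ->
  pairing u (cyc s i) = c -> pairing u (cyc s i.+1) = c ->
  pairing v (cyc s i.+1) = c -> pairing v (cyc s i.+2) = c ->
  primitive L (cyc s i.+1).
Proof.
move=> l0 rs uv u0 u1 v1 v2.
have [//|straight] := loop_primitive_or_straight i rs.
case/eqP: uv; apply: (pairing_inj (loop_det_neq0 i.+1 l0 rs));
  rewrite ?u1 ?v1 //.
rewrite v2; have -> : cyc s i.+2 = 2 *: cyc s i.+1 + (-1) *: cyc s i.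
  rewrite -[LHS](subrK (cyc s i.+1)) straight.
  by apply/point_eqP; rewrite !mxE; split; ring.
by rewrite pairingDr !pairingZr u0 u1; ring.
Qed.

Lemma dual_loopP L l s d : dual_loop L l s d -> s != [::] ->
  exists (u : seq point) (ps : seq (seq point)),
    [/\ size u = size s /\ size ps = size s,
      forall i, [/\ primitive (dual_lattice L) (cyc u i),
        pairing (cyc u i) (cyc s i) = l%:R & pairing (cyc u i) (cyc s i.+1) =
          l%:R],
      forall i, (i < size s)%N ->
        traverses (dual_lattice L) (cyc u i) (cyc u i.+1) (nth [::] ps i)
      & d = omit_repeats (flatten ps)].
Proof.
move=> [u [ps [[su sps] uP psP dE]]] s0; exists u, ps; split=> // i.
have n0 : (0 < size s)%N by case: (s) s0.
have := uP (i %% size s)%N; rewrite ltn_mod n0 => /(_ isT)[].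
have e m : cyc s (i %% size s + m) = cyc s (i + m) := cyc_modD s i m.
have eu : cyc u (i %% size s) = cyc u i.
  by have := cyc_modD u i 0; rewrite su !addn0.
by rewrite /cyc_next -addn1 e eu; have := e 0%N; rewrite !addn0 addn1 => ->.
Qed.

Lemma det2_addZ (x y : point) a : det2 x (x + a *: y) = a * det2 x y.
Proof. by rewrite /det2 !mxE; ring. Qed.

Lemma dual_step L B l s i u v p c : (0 < l)%N -> lattice_basis L B ->
  reflexive_loop L l s ->
  dual_lattice L u -> dual_lattice L v -> traverses (dual_lattice L) u v p ->
  pairing u (cyc s i) = l%:R -> pairing u (cyc s i.+1) = l%:R ->
  pairing v (cyc s i.+1) = l%:R -> pairing v (cyc s i.+2) = l%:R ->
  (c.+1 < size p)%N ->
  [/\ dual_lattice L p`_c, p`_c != 0,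
    primitive (dual_lattice L) (p`_c.+1 - p`_c)
    & `|det_wrt (invmx B)^T p`_c p`_c.+1| = l%:R].
Proof.
move=> l0 bL rs Lu Lv tp u0 u1 v1 v2 hc.
have bD := dual_basis bL; have dB0 := lattice_basis_neq0 bL.
have [uv Pd] := traverses_step_primitive bD Lu Lv tp hc.
have Px := distinct_normals_primitive l0 rs uv u0 u1 v1 v2.
move: (cyc s i.+1) Px u1 v1 {u0 v2} => x Px ux vx.
have inp e : (e < size p)%N -> dual_lattice L p`_e /\ pairing p`_e x = l%:R.
  move=> he; case: tp => _ /(_ p`_e)[/(_ (mem_nth 0 he))[Lp seg] _] _.
  by split=> //; exact: in_segment_pairing seg ux vx.
have [[La ax] [Lb bx]] := (inp c (ltnW hc), inp c.+1 hc).
move: (p`_c) (p`_c.+1) La ax Lb bx Pd => a b La ax Lb bx Pd.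
have x0 : x != 0 by case: Px.
have [q dE] : exists q, b - a = q *: rho B x.
  apply: (orthogonal_rho bL x0).
  by rewrite -scaleN1r pairingDl pairingZl ax bx; ring.
split=> //.
  apply: contraTneq l0 => a0; move: ax; rewrite a0 pairingE !mxE !mul0r addr0.
  by move/esym/eqP; rewrite pnatr_eq0 => /eqP ->.
(* The determinant of [a] with the quarter turn of [x] is the pairing of [a] with [x], which is l;
   and [q] is 1 or -1 because the step and the quarter turn are both primitive. *)
have -> : det_wrt (invmx B)^T a b = q * l%:R.
  rewrite det_wrtE det_dual_basis invrK.
  have -> : b = a + q *: rho B x by rewrite -dE addrC subrK.
  by rewrite det2_addZ det2_rho ax; field.
have := primitive_parallel bD (primitive_rho bL Px) Pd dE.
by case=> ->; rewrite ?mul1r ?mulN1r ?normrN ger0_norm ?ler0n.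
Qed.

Lemma constant_normals_line L l s u : (0 < l)%N -> reflexive_loop L l s ->
  (forall x, x \in s -> pairing u x = l%:R) -> contained_in_line s.
Proof.
move=> l0 rs ux; have [s0 _ [B bL _]] := reflexive_loopP rs.
have x0 := cyc_mem 0 s0; have u0 : u != 0.
  apply: contraTneq l0 => u0; move: (ux _ x0);
    rewrite u0 pairingE !mxE !mul0r addr0.
  by move/esym/eqP; rewrite pnatr_eq0 => /eqP ->.
exists (cyc s 0), (rho B u) => x /ux h.
have [|a aE] := orthogonal_rho (u := x - cyc s 0) bL u0; last first.
  by exists a; rewrite -aE addrC subrK.
by rewrite -scaleN1r pairingDl pairingZl !(pairingC _ u) h (ux _ x0); ring.
Qed.

(** The end of one traversal equals the start of the next, and this repetition is omitted; so every
    step of the dual loop lies inside one traversal, where [dual_step] applies. Points inside a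
    traversal are not vertices, and its ends are outer normals, hence primitive. *)
Lemma dual_reflexive L l s d : (0 < l)%N -> reflexive_loop L l s ->
  dual_loop L l s d -> ~ contained_in_line s ->
  reflexive_loop (dual_lattice L) l d.
Proof.
move=> l0 rs dd nline; have [s0 _ [B bL _]] := reflexive_loopP rs.
have n0 : (0 < size s)%N by case: (s) s0.
have [u [ps [[su sps] uP psP dE]]] := dual_loopP dd s0.
have bD := dual_basis bL; have Lu i : dual_lattice L (cyc u i)
  by case: (uP i) => -[].
have ends i : (i < size s)%N -> [/\ (0 < size (nth [::] ps i))%N,
    (nth [::] ps i)`_0 = cyc u i
    & (nth [::] ps i)`_(size (nth [::] ps i)).-1 = cyc u i.+1].
  by move/psP/(traverses_ends (Lu i) (Lu i.+1)).
have uS i : cyc u (i.+1 %% size ps) = cyc u i.+1.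
  by have := cyc_modD u i.+1 0; rewrite !addn0 su sps.
(* A constant list would make all outer normals equal, and the loop would lie on one line. *)
have ncs : ~~ constant (flatten ps).
  apply/negP => /(constantP (0 : point))[w wE]; apply: nline.
  apply: (constant_normals_line (u := w) l0 rs) => x /mem_cyc[i hi ->].
  have -> : w = cyc u i.
    have [h0 h1 _] := ends i hi.
    have : cyc u i \in flatten ps.
      apply/flattenP; exists (nth [::] ps i); first by rewrite mem_nth ?sps.
      by rewrite -h1 mem_nth.
    by rewrite wE mem_nseq => /andP[_ /eqP].
  by case: (uP i).
have [d0 [idx idxP]] := omit_repeats_steps ncs; rewrite -dE in d0 idxP.
set S := flatten ps in idxP.
have sizes i : (i < size ps)%N -> (0 < size (nth [::] ps i))%N.
  by rewrite sps => /ends[].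
have step k : exists i c, [/\ (i < size s)%N, (c.+1 < size (nth [::] ps i))%N,
    cyc d k = (nth [::] ps i)`_c & forall e, (c + e < size (nth [::] ps i))%N ->
      cyc S ((idx k.+1).-1 + e) = (nth [::] ps i)`_(c + e)].
  (* [m] is the last index before the value changes; it cannot end a block, since the next block
     starts with the same point. *)
  have [lt_k dk ne stay] := idxP k; set m := (idx k.+1).-1.
  have mE : m.+1 = idx k.+1 by rewrite prednK // (leq_ltn_trans _ lt_k).
  have dm : cyc d k = cyc S m by rewrite dk stay // -ltnS mE lt_k leqnn.
  have [|i [c [hi hc he ce]]] := cyc_flatten m _ sizes; first by rewrite sps.
  have Sm : cyc S m = (nth [::] ps i)`_c by have := he 0%N; rewrite !addn0;
    apply.
  rewrite sps in hi; exists i, c; split=> //; last by rewrite dm.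
  rewrite ltn_neqAle hc andbT; apply: contraNneq ne => cE.
  have [_ _ last_i] := ends i hi; have := ce cE.
  have -> : (nth [::] ps (i.+1 %% size ps))`_0 = cyc u i.+1.
    by have [|_ -> _] := ends (i.+1 %% size ps)%N; rewrite ?uS // sps ltn_mod.
  by rewrite mE => ->; rewrite -dk dm Sm -last_i -cE.
have stepP k : [/\ dual_lattice L (cyc d k), cyc d k != 0,
    primitive (dual_lattice L) (cyc d k.+1 - cyc d k)
    & `|det_wrt (invmx B)^T (cyc d k) (cyc d k.+1)| = l%:R].
  have [i [c [hi hc -> he]]] := step k.
  have -> : cyc d k.+1 = (nth [::] ps i)`_c.+1.
    have [lt_k _ _ _] := idxP k; have [_ -> _ _] := idxP k.+1.
    by have := he 1%N; rewrite !addn1 prednK ?(leq_ltn_trans _ lt_k) //; apply.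
  have [[_ u0 u1] [_ v1 v2]] := (uP i, uP i.+1).
  exact: (dual_step l0 bL rs (Lu i) (Lu i.+1) (psP i hi) u0 u1 v1 v2 hc).
split=> //.
  by move=> x /mem_cyc[k _ ->]; case: (stepP k).
exists (invmx B)^T => // k hk; have [_ _ Pd det] := stepP k; split=> //.
(* Everything is re-indexed from the predecessor [k'], so that the vertex is reached by a step
   inside a known block. *)
rewrite /is_vertex /cyc_prev /cyc_next; set k' := (k + _)%N.
have kE : cyc d k = cyc d k'.+1.
  by rewrite /k' -addnS prednK ?cyc_addn // (leq_ltn_trans _ hk).
have kSE : cyc d k.+1 = cyc d k'.+2.
  by rewrite /k' -!addnS -addSnnS prednK ?cyc_addn // (leq_ltn_trans _ hk).
rewrite kE kSE => vert.
have [i [c [hi hc dk' he]]] := step k'.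
have [lt1 _ _ _] := idxP k'; have [lt2 dk1 _ stay] := idxP k'.+1.
have [_ dk2 _ _] := idxP k'.+2.
have qE : (idx k'.+1).-1.+1 = idx k'.+1
  by rewrite prednK // (leq_ltn_trans _ lt1).
have dk1E : cyc d k'.+1 = (nth [::] ps i)`_c.+1.
  by have := he 1%N; rewrite !addn1 qE -dk1; apply.
have [_ _ last_i] := ends i hi.
(* Either the point ends its traversal and is the normal u_(i+1), or both neighbours lie in the same
   traversal. *)
move: hc; rewrite leq_eqVlt => /predU1P[cE|hc].
  by rewrite dk1E -[c.+1]/(c.+2.-1) cE last_i; case: (uP i.+1).
(* Points of one traversal are distinct, so the value changes again at the very next index. *)
case: vert; have rE : idx k'.+2 = (idx k'.+1).+1.
  apply/eqP; rewrite eqn_leq lt2 andbT leqNgt; apply/negP => lt3.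
  have [_ ne _] := (traverses_step_primitive bD (Lu i) (Lu i.+1) (psP i hi)
    hc).2.
  have := he 2%N; rewrite !addn2 qE => /(_ hc) E.
  by case/eqP: ne; rewrite -E -dk1E dk1 stay ?subrr // lt3 andbT leqnSn.
have dk2E : cyc d k'.+2 = (nth [::] ps i)`_c.+2.
  by have := he 2%N; rewrite !addn2 qE -rE -dk2; apply.
rewrite dk' dk1E dk2E.
exact: traverses_interior (Lu i) (Lu i.+1) (psP i hi) hc.
Qed.
(** * Comparison of the two dual loops *)

(** The coordinates of [v] with respect to x_0 and x_1 are integral determinants divided by l or
    -l. *)
Lemma scale_generated L B l s v : (0 < l)%N -> lattice_basis L B ->
  reflexive_loop L l s -> L v -> generated_lattice s (l%:R *: v).
Proof.
move=> l0 bL rs Lv; have nz := loop_det_neq0 0 l0 rs.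
have lR : (l%:R : rat) != 0 by rewrite pnatr_eq0 -lt0n.
have bG := generated_basis l0 rs.
have [s0 _ [B' bL' h]] := reflexive_loopP rs.
have [[Lx _ d _] [Ly _ _ _]] := (h 0%N, h 1%N).
have dB0 := lattice_basis_neq0 bL'.
have coef p q : L p -> L q ->
    l%:R * (det2 p q / det2 (cyc s 0) (cyc s 1)) \is a Num.int.
  move=> Lp Lq; have -> : det2 p q / det2 (cyc s 0) (cyc s 1) =
      det_wrt B' p q / det_wrt B' (cyc s 0) (cyc s 1).
    by rewrite !det_wrtE; field; rewrite dB0.
  have ipq := det_wrt_int bL' Lp Lq.
  move/eqP: d; rewrite eqr_norml => /andP[/orP[]/eqP -> _].
    by rewrite mulrC divfK.
  by rewrite invrN mulrN mulrN rpredN mulrC divfK.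
rewrite (det2_cramer v nz) scalerDr !scalerA.
by apply: (lattice_comb bG); try exact: coef; apply/generated_mem/cyc_mem.
Qed.

(** A homothety keeps the parameters. The lattices are compared on the segment only, which is all
    that [segment_scale] provides. *)
Lemma traverses_scale (L L' : lattice) u v p a : a != 0 ->
  (forall z, in_segment u v z -> L z <-> L' (a *: z)) ->
  traverses L u v p ->
  traverses L' (a *: u) (a *: v) [seq a *: z | z <- p].
Proof.
move=> a0 LL' [Up Mp [r sr pE]].
have paramZ b : a *: u + b *: (a *: v - a *: u) = a *: (u + b *: (v - u)).
  by apply/point_eqP; rewrite !mxE; split; ring.
split.
- by rewrite (map_inj_uniq (scalerI a0)).
- have seg z : in_segment (a *: u) (a *: v) (a *: z) <-> in_segment u v z.
    rewrite !in_segment_param; split=> -[b b01 zE]; exists b => //.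
      by apply: (scalerI a0); rewrite zE paramZ.
    by rewrite zE paramZ.
  move=> z; have zE : z = a *: (a^-1 *: z) by rewrite scalerA divff ?scale1r.
  rewrite zE (mem_map (scalerI a0)) Mp seg.
  by split=> -[Lz sz]; split=> //; apply/(LL' _ sz).
exists r => //; rewrite pE -map_comp; apply: eq_map => b /=.
by rewrite paramZ.
Qed.

(** The condition [f 0 = 0] accounts for the default value 0 that [cyc] returns on the empty
    list. *)
Lemma omit_repeats_map (f : point -> point) s : injective f -> f 0 = 0 ->
  omit_repeats (map f s) = map f (omit_repeats s).
Proof.
move=> fi f0; have cf i : cyc (map f s) i = f (cyc s i).
  rewrite /cyc size_map; have [h|h] := ltnP (i %% size s) (size s).
    by rewrite (nth_map 0).
  by rewrite !nth_default ?size_map // f0.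
rewrite /omit_repeats; have -> : constant (map f s) = constant s.
  by case: s {cf} => //= x s; rewrite all_map; apply: eq_all => y /=;
    rewrite (inj_eq fi).
case: ifP => _; first by rewrite map_take.
rewrite -map_comp size_map -(eq_map cf); congr map; apply: eq_filter => i.
by rewrite /cyc_prev size_map !cf (inj_eq fi).
Qed.

(* For the converse inclusion: l z pairs to l with the primitive x_(i+1), so  *)
(* l z - l u is an integral multiple of its quarter turn; hence l z also      *)
(* pairs to a multiple of l with x_i, and z is integral on the lattice        *)
(* generated by x_i and x_(i+1).                                              *)
Lemma segment_scale L B l s i (u v z : point) : (0 < l)%N ->
  lattice_basis L B ->
  reflexive_loop L l s ->
  dual_lattice (generated_lattice s) u ->
  pairing u (cyc s i) = 1 -> pairing u (cyc s i.+1) = 1 ->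
  pairing v (cyc s i.+1) = 1 -> pairing v (cyc s i.+2) = 1 ->
  in_segment u v z ->
  dual_lattice (generated_lattice s) z <-> dual_lattice L (l%:R *: z).
Proof.
move=> l0 bL rs Lu u0 u1 v1 v2 seg.
have lR : (l%:R : rat) != 0 by rewrite pnatr_eq0 -lt0n.
have scale_dual w : dual_lattice (generated_lattice s) w ->
  dual_lattice L (l%:R *: w).
  move=> Lw x Lx; rewrite pairingZl -pairingZr; apply: Lw.
  exact: (scale_generated l0 bL rs).
split=> [|Lz]; first exact: scale_dual.
have [uv|uv] := eqVneq u v.
  by case/in_segment_param: seg => a _ ->; rewrite -uv subrr scaler0 addr0.
have Px := distinct_normals_primitive l0 rs uv u0 u1 v1 v2.
have zx : pairing z (cyc s i.+1) = 1 := in_segment_pairing seg u1 v1.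
have [_ _ [B' bL' h]] := reflexive_loopP rs.
have [Lx _ d _] := h i; have bD := dual_basis bL'.
have x0 : cyc s i.+1 != 0 by case: Px.
have [q qE] : exists q, l%:R *: z - l%:R *: u = q *: rho B' (cyc s i.+1).
  apply: (orthogonal_rho bL' x0).
  by rewrite -scaleN1r pairingDl !pairingZl zx u1; ring.
have iq : q \is a Num.int.
  apply: (primitive_int bD (primitive_rho bL' Px)); rewrite -qE.
  by apply: (latticeB bD) => //; exact: scale_dual.
have zi : pairing z (cyc s i) \is a Num.int.
  have : pairing z (cyc s i) = 1 + q * (det_wrt B' (cyc s i.+1) (cyc s i) /
    l%:R).
    apply: (mulfI lR); rewrite -pairingZl -[l%:R *: z](subrK (l%:R *: u)) qE.
    by rewrite pairingDl (pairingZl q) pairing_rho pairingZl u0; field.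
  move=> ->; rewrite rpredD // rpredM //.
  rewrite !det_wrtE det2C mulNr mulNr rpredN -det_wrtE.
  by move/eqP: d; rewrite eqr_norml => /andP[/orP[]/eqP -> _];
    rewrite ?mulNr ?rpredN divff.
move=> w Gw; have rG := generated_reflexive l0 rs.
have [_ _ [C bG hG]] := reflexive_loopP rG.
have [[Gx _ dG _] [Gy _ _ _]] := (hG i, hG i.+1).
have [a [b [ia ib ->]]] := unimodular_span bG Gx Gy dG Gw.
by rewrite pairingDr !pairingZr zx rpredD // rpredM.
Qed.

(** The normals differ by the factor l because they take proportional values on two independent
    points. [segment_scale] then matches the lattice points of the segments, and [traverses_unique]
    fixes their order. *)
Lemma dual_loop_scale L l s d1 d : (0 < l)%N -> reflexive_loop L l s ->
  dual_loop (generated_lattice s) 1 s d1 -> dual_loop L l s d ->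
  d = [seq l%:R *: z | z <- d1].
Proof.
move=> l0 rs dd1 dd; have [s0 _ [B bL h]] := reflexive_loopP rs.
have lR : (l%:R : rat) != 0 by rewrite pnatr_eq0 -lt0n.
have [u1 [p1 [[su1 sp1] uP1 pP1 ->]]] := dual_loopP dd1 s0.
have [u [p [[su sp] uP pP ->]]] := dual_loopP dd s0.
have uE i : cyc u i = l%:R *: cyc u1 i.
  have [[_ a0 a1] [_ b0 b1]] := (uP1 i, uP i).
  by apply: (pairing_inj (loop_det_neq0 i l0 rs));
    rewrite pairingZl ?a0 ?a1 ?b0 ?b1 mulr1.
rewrite -omit_repeats_map ?scaler0 //; last exact: scalerI.
congr omit_repeats; rewrite map_flatten; congr flatten.
apply: (eq_from_nth (x0 := [::])) => [|i]; rewrite ?size_map sp ?sp1 // => hi.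
rewrite (nth_map [::]) ?sp1 //.
apply: traverses_unique (pP i hi) _; rewrite !uE.
have [[[Lu _ _] a0 a1] [_ b0 b1]] := (uP1 i, uP1 i.+1).
apply: traverses_scale (pP1 i hi) => // z.
exact: (segment_scale l0 bL rs Lu a0 a1 b0 b1).
Qed.

(** Two consecutive points have determinant 1 or -1, so they already span [L]. *)
Lemma reflexive1_generated L s v : reflexive_loop L 1 s -> L v ->
  generated_lattice s v.
Proof.
move=> rs Lv; have [s0 _ [B bL h]] := reflexive_loopP rs.
have bG := generated_basis (leqnn 1) rs.
have [[L0 _ d _] [L1 _ _ _]] := (h 0%N, h 1%N).
have [a [b [ia ib ->]]] := unimodular_span bL L0 L1 d Lv.
by apply: (lattice_comb bG) => //; apply/generated_mem/cyc_mem.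
Qed.

Lemma generated_scale (s : seq point) a v : generated_lattice s v ->
  generated_lattice [seq a *: x | x <- s] (a *: v).
Proof.
move=> [c ->]; pose e := size_map (fun x : point => a *: x) s.
exists [ffun i => c (cast_ord e i)].
rewrite scaler_sumr (reindex (cast_ord e)) /=; last first.
  by apply: onW_bij; exists (cast_ord (esym e));
    [exact: cast_ordK|exact: cast_ordKV].
apply: eq_bigr => i _; rewrite ffunE (nth_map 0) -?[X in (_ < X)%N]e ?ltn_ord
  //.
by rewrite scalerMzr.
Qed.

Lemma scaled_loop_isomorphic L d a (ad := [seq a *: x | x <- d]) :
  a != 0 -> reflexive_loop L 1 d ->
  loop_isomorphic L d (generated_lattice ad) ad.
Proof.
move=> a0 rd; exists (fun v => a *: v).
have [_ _ [B bL h]] := reflexive_loopP rd; split.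
- by move=> v Lv; apply/generated_scale/(reflexive1_generated rd).
- by move=> v w _ _; rewrite scalerDr.
- by move=> v w _ _; exact: scalerI.
(* Surjectivity: the inverse homothety sends the lattice generated by [ad] to the one generated by
   [d], which lies in [L]. *)
- move=> w Gw; exists (a^-1 *: w); last by rewrite scalerA divff ?scale1r.
  apply: (generated_min bL (s := d)) => [x /mem_cyc[i _ ->]|];
    first by case: (h i).
  have := generated_scale a^-1 Gw; rewrite -map_comp.
  by rewrite (eq_map (g := id)) ?map_id // => x /=;
    rewrite scalerA mulVf ?scale1r.
by exists 0%N; rewrite rot0.
Qed.

Theorem corollary2p4 (l : nat) (P : seq point) (hl : (0 < l)%N)
    (hP : reflexive_loop std_lattice l P) :
  [/\ reflexive_loop (generated_lattice P) 1 P,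
      exists D1, dual_loop (generated_lattice P) 1 P D1,
      exists D, dual_loop std_lattice l P D
    & forall D1 D : seq point,
        dual_loop (generated_lattice P) 1 P D1 ->
        dual_loop std_lattice l P D ->
        ~ contained_in_line P ->
        [/\ reflexive_loop (dual_lattice (generated_lattice P)) 1 D1,
            reflexive_loop (dual_lattice std_lattice) l D,
            reflexive_loop (generated_lattice D) 1 D
          & loop_isomorphic (dual_lattice (generated_lattice P)) D1
                            (generated_lattice D) D]].
Proof.
have rG := generated_reflexive hl hP.
split=> //; [exact: dual_loop_exists rG|exact: dual_loop_exists hP|].
move=> D1 D dD1 dD nline.
have rD1 := dual_reflexive (leqnn 1) rG dD1 nline.
have rD := dual_reflexive hl hP dD nline.
split=> //; first exact: generated_reflexive rD.
rewrite (dual_loop_scale hl hP dD1 dD); apply: scaled_loop_isomorphic => //.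
by rewrite pnatr_eq0 -lt0n.
Qed.
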